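(* Let $n\ge 3$ be an integer and $p=\lfloor \frac{n+1}{2}\rfloor$. Let $\mathcal A=\{h_1,\dots,h_n\}$ be the arrangement of lines in $\mathbb R^2$ obtained by extending the edges of a regular $n$-gon (the cyclic model $C_n$), with its regions ordered $R_0,R_1,\dots,R_{np}$ as described in the context. Then the $q$-Varchenko matrix of $\mathcal A$ is the $(1+np)\times(1+np)$ matrix with block form $$V_q=\begin{pmatrix}1 & Q_1 & Q_2 & \cdots & Q_p\\ Q_1^t & C_{11} & C_{12} & \cdots & C_{1p}\\ Q_2^t & C_{21} & C_{22} & \cdots & C_{2p}\\ \vdots & \vdots & \vdots & \ddots & \vdots\\ Q_p^t & C_{p1} & C_{p2} & \cdots & C_{pp}\end{pmatrix},$$ where $Q_r=(q^r,\dots,q^r)$ is the row vector of length $n$, and for $1\le i\le j\le p$ the block $C_{ij}$ is the $n\times n$ circulant matrix with first row $$\big(q^{j-i},q^{j-i+2},\dots,q^{j-i+2(i-1)},\ \underbrace{q^{i+j},\dots,q^{i+j}}_{n+1-i-j},\ q^{j-i+2(i-1)},q^{j-i+2(i-2)},\dots,q^{j-i+2},\ \underbrace{q^{j-i},\dots,q^{j-i}}_{j-i}\big)$$ (the first group has $i$ entries, the third group has $i-1$ entries), and $C_{ji}=C_{ij}^t$.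
   Context: For a hyperplane arrangement $\mathcal A$, the regions are the connected components of the complement of the union of the hyperplanes; $sep(R,R')$ is the set of hyperplanes of $\mathcal A$ separating $R$ from $R'$. The $q$-Varchenko matrix $V_q$ is indexed by the regions (in a chosen order), with $(R,R')$-entry $q^{\#sep(R,R')}$. Labelling: $h_1,\dots,h_n$ are the lines extending the edges of the $n$-gon, numbered consecutively counter-clockwise (indices mod $n$). $R_0$ is the interior of the $n$-gon. There are $1+np$ regions; for $1\le r\le p$, $1\le x\le n$, $R_{(r-1)n+x}$ is the region with $sep(R_0,R_{(r-1)n+x})=\{h_x,h_{x+1},\dots,h_{x+r-1}\}$ (indices mod $n$). The regions are ordered $R_0,R_1,\dots,R_{np}$. The circulant matrix with first row $(a_1,\dots,a_n)$ is the matrix whose second row is $(a_n,a_1,\dots,a_{n-1})$, and so on, each row being the cyclic right shift of the preceding one. $M^t$ is the transpose of $M$. *)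

(* Defs.v *)
From HB Require Import structures.
From mathcomp Require Import all_boot all_order all_algebra finmap.
From mathcomp Require Import all_classical all_reals all_analysis.
From mathcomp Require Import zify ring lra.
Set Implicit Arguments.
Unset Strict Implicit.
Unset Printing Implicit Defensive.
Import Order.TTheory GRing.Theory Num.Theory numFieldNormedType.Exports.
Local Open Scope classical_set_scope.
Local Open Scope ring_scope.

Section Arrangements.
Variables (R : realType) (d : nat).
Implicit Types (A : set (set 'rV[R]_d)) (H C D : set 'rV[R]_d).

Definition dotrv (a x : 'rV[R]_d) : R := \sum_i a 0 i * x 0 i.

Definition arr_complement A : set 'rV[R]_d := ~` \bigcup_(H in A) H.

Definition regions A : set (set 'rV[R]_d) :=
  [set connected_component (arr_complement A) x | x in arr_complement A].

(* C and D lie in opposite open half-spaces bounded by H. *)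
Definition separates H C D : Prop :=
  exists (a : 'rV[R]_d) (b : R),
    [/\ H = [set x | dotrv a x = b],
        C `<=` [set x | dotrv a x < b] &
        D `<=` [set x | b < dotrv a x]].

Definition sep A C D : set (set 'rV[R]_d) :=
  [set H | A H /\ separates H C D].

(* Rg lists the regions in the chosen order.  The cardinality is the intended
   one only when A is finite, since fset_set sends infinite sets to fset0. *)
Definition varchenko_mx (K : comNzRingType) (q : K) A m
    (Rg : 'I_m -> set 'rV[R]_d) : 'M[K]_m :=
  \matrix_(i, j) q ^+ #|` fset_set (sep A (Rg i) (Rg j))|.

Definition convex_hull m (v : 'I_m -> 'rV[R]_d) : set 'rV[R]_d :=
  [set x | exists w : 'I_m -> R,
    [/\ forall i, 0 <= w i, \sum_i w i = 1 & x = \sum_i w i *: v i]].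

Definition line (P Q : 'rV[R]_d) : set 'rV[R]_d :=
  [set P + t *: (Q - P) | t in [set: R]].

End Arrangements.

(* Every regular n-gon has the vertices below (in counter-clockwise order) for
   some centre c, circumradius rho > 0 and angle theta. *)
Section CyclicModel.
Variables (R : realType) (n : nat) (c : 'rV[R]_2) (rho theta : R).

Definition vertex (k : nat) : 'rV[R]_2 :=
  let phi := theta + 2 * pi * k%:R / n%:R in
  c + rho *: \row_(j < 2) (if j == 0 then cos phi else sin phi).

Definition edge_line (k : nat) : set 'rV[R]_2 := line (vertex k) (vertex k.+1).

(* So that the indices of edge_line can be read modulo n. *)
Lemma edge_lineDn k : (0 < n)%N -> edge_line (k + n) = edge_line k.
Proof.
move=> n0; have vD m : vertex (m + n) = vertex m.
  rewrite /vertex; have -> : theta + 2 * pi * (m + n)%:R / n%:R =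
      theta + 2 * pi * m%:R / n%:R + pi *+ 2 :> R.
    rewrite natrD; field; by rewrite pnatr_eq0 -lt0n.
  move: (theta + _) => phi.
  by rewrite cosD sinD cos2pi sin2pi !mulr0 !mulr1 subr0 addr0.
by rewrite /edge_line -addSn !vD.
Qed.

Definition cyclic_model : set (set 'rV[R]_2) :=
  [set edge_line k | k in [set k | (1 <= k <= n)%N]].

Definition polygon_interior : set 'rV[R]_2 :=
  interior (convex_hull (fun k : 'I_n => vertex k)).

Definition cyclic_labelling (p : nat)
    (Rg : 'I_(1 + n * p) -> set 'rV[R]_2) : Prop :=
  [/\ injective Rg,
      range Rg = regions cyclic_model,
      Rg ord0 = polygon_interior &
      forall (r x : nat) (l : 'I_(1 + n * p)),
        (1 <= r <= p)%N -> (1 <= x <= n)%N -> l = ((r - 1) * n + x)%N :> nat ->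
        sep cyclic_model (Rg ord0) (Rg l) =
          [set edge_line (x + k) | k in [set k | (k < r)%N]]].

End CyclicModel.

Section BlockForm.
Variables (K : comNzRingType) (q : K) (n : nat).

(* The circulant matrix with first row s, where size s = n. *)
Definition circulant (s : seq K) : 'M[K]_n :=
  \matrix_(i, j) (rotr i s)`_j.

Definition first_row (i j : nat) : seq K :=
  [seq q ^+ (j - i + 2 * k) | k <- iota 0 i] ++
  nseq (n + 1 - i - j) (q ^+ (i + j)) ++
  [seq q ^+ (j - i + 2 * k) | k <- rev (iota 1 (i - 1))] ++
  nseq (j - i) (q ^+ (j - i)).

Lemma size_first_row i j :
  (1 <= i <= j)%N -> (i + j <= n + 1)%N -> size (first_row i j) = n.
Proof.
by move=> *; rewrite !size_cat !size_map size_rev !size_iota !size_nseq; lia.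
Qed.

Definition block_C (i j : nat) : 'M[K]_n :=
  if (i <= j)%N then circulant (first_row i j)
  else (circulant (first_row j i))^T.

Definition block_Q (r : nat) : 'rV[K]_n := const_mx (q ^+ r).

Lemma block_dim p : (1 + \sum_(r < p) n = 1 + n * p)%N.
Proof. by rewrite sum_nat_const card_ord mulnC. Qed.

(* mxrow and mxblock count blocks from 0, the indices r, i, j of the blocks
   start at 1. *)
Definition block_form (p : nat) : 'M[K]_(1 + n * p) :=
  castmx (block_dim p, block_dim p)
    (block_mx 1%:M (\mxrow_(r < p) block_Q r.+1)
              (\mxcol_(r < p) (block_Q r.+1)^T)
              (\mxblock_(i < p, j < p) block_C i.+1 j.+1)).

End BlockForm.

(* Main.v *)
(* Every edge line k has a function [edge_gap k], affine on the plane and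
   positive at the centre of the polygon, whose zero set is the line.  In polar
   coordinates about the centre, [edge_gap k] is negative exactly when
   cos (angle to the k-th normal) exceeds a positive threshold.  The normals
   being equally spaced, the set of such k is a cyclic interval, spanning an
   angle less than pi and hence having at most p elements; conversely each
   cyclic interval with at most p elements occurs.  The sets on which all the
   signs of the gaps are fixed are convex, so they are the regions, and the
   lines separating two regions form the symmetric difference of two cyclic
   intervals.  The block form lists the sizes of these symmetric differences. *)
Require Import Defs.
From mathcomp Require Import all_boot all_order all_algebra.
From mathcomp Require Import all_classical all_reals all_analysis.
From mathcomp Require Import finmap zify ring lra.
Set Implicit Arguments.
Unset Strict Implicit.
Unset Printing Implicit Defensive.
Import Order.TTheory GRing.Theory Num.Theory numFieldNormedType.Exports.
Local Open Scope classical_set_scope.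
Local Open Scope ring_scope.

(** * Cyclic intervals of indices *)

Section CyclicArcs.
Local Open Scope nat_scope.
Variable n : nat.

(* For x <= n: k is congruent modulo n to one of x, ..., x + r - 1.
   The truncated n - x stands for - x. *)
Definition in_arc (x r k : nat) : bool := (k + (n - x)) %% n < r.

Lemma in_arc_mod x r k : in_arc x r (k %% n) = in_arc x r k.
Proof. by rewrite /in_arc modnDml. Qed.

Lemma in_arcDn x r k : in_arc x r (k + n) = in_arc x r k.
Proof. by rewrite -in_arc_mod modnDr in_arc_mod. Qed.

Lemma in_arcDl x r j : x <= n -> j < n -> in_arc x r (x + j) = (j < r).
Proof.
by move=> xn jn; rewrite /in_arc (_ : x + j + (n - x) = j + n) ?modnDr ?modn_small //; lia.
Qed.

(** Translating the index by x turns any pair of arcs into one whose first arc starts at 0. The two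
    cases are whether y - x wraps around. *)
Lemma in_arcDx x y r k d : 1 <= x <= n -> 1 <= y <= n -> d = (y + n - x) %% n ->
  in_arc y r (k + x) = in_arc d r k.
Proof.
move=> hx hy ->; rewrite /in_arc; have [xy|yx] := leqP x y.
  rewrite (_ : y + n - x = y - x + n); last lia.
  rewrite modnDr (_ : (y - x) %% n = y - x); last by apply: modn_small; lia.
  by rewrite (_ : k + x + (n - y) = k + (n - (y - x))) //; lia.
rewrite (_ : (y + n - x) %% n = y + n - x); last by apply: modn_small; lia.
by rewrite (_ : k + x + (n - y) = k + (n - (y + n - x)) + n) ?modnDr //; lia.
Qed.

Lemma in_arc_small d r k : d < n -> k < n ->
  in_arc d r k = if d <= k then k - d < r else k + n - d < r.
Proof.
move=> dn kn; rewrite /in_arc; case: (leqP d k) => dk.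
  by rewrite (_ : k + (n - d) = k - d + n) ?modnDr ?modn_small //; lia.
by rewrite modn_small ?addnBA //; lia.
Qed.

(** Induction on x: the windows of length n starting at x and at x + 1 lie in a common window of
    length n + 1, and the terms that they omit, [f (x + n)] and [f x], agree. *)
Lemma sum_periodic (f : nat -> nat) x :
  (forall k, f (k + n) = f k) -> \sum_(k < n) f (k + x) = \sum_(k < n) f k.
Proof.
move=> fn; elim: x => [|x <-]; first by apply: eq_bigr => k _; rewrite addn0.
apply/(@addnI (f x)).
transitivity (\sum_(k < n.+1) f (k + x)); last first.
  by rewrite big_ord_recr /= [n + x]addnC fn addnC.
rewrite big_ord_recl; congr (_ + _); apply: eq_bigr => k _.
by rewrite /= /bump leq0n add1n addSnnS.
Qed.

Lemma sum_two_intervals a b c e m : a <= b <= c -> c <= e ->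
  \sum_(k < m) ((a <= k < b) || (c <= k < e)) =
  minn b m - a + (minn e m - c).
Proof.
move=> abc ce; elim: m => [|m IH]; first by rewrite big_ord0; lia.
rewrite big_ord_recr /= IH.
by case: (leqP a m); case: (ltnP m b); case: (leqP c m); case: (ltnP m e) => /=; lia.
Qed.

(** The size of the symmetric difference of two arcs, which becomes the exponent of q in the
    matrix. *)
Definition arc_dist (x i y j : nat) : nat := \sum_(k < n) (in_arc x i k != in_arc y j k).

Lemma arc_distC x i y j : arc_dist x i y j = arc_dist y j x i.
Proof. by apply: eq_bigr => k _; rewrite eq_sym. Qed.

Lemma arc_dist_shift x i y j d : 1 <= x <= n -> 1 <= y <= n ->
  d = (y + n - x) %% n -> arc_dist x i y j = arc_dist 0 i d j.
Proof.
move=> hx hy hd; rewrite /arc_dist.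
rewrite -(@sum_periodic (fun k => in_arc x i k != in_arc y j k) x).
  apply: eq_bigr => k _; rewrite (@in_arcDx x y j k d) // (@in_arcDx x x i k 0) //.
  by rewrite addnC addnK modnn.
by move=> k; rewrite !in_arcDn.
Qed.

(** As d grows, the second arc in turn starts inside the first, is disjoint from it, wraps around to
    cover its beginning, and contains it. The bound on i + j excludes partial overlaps at both ends,
    so each symmetric difference consists of two ordinary intervals below n. *)
Lemma arc_dist0E i j d : 1 <= i <= j -> i + j <= n + 1 -> d < n ->
  arc_dist 0 i d j =
  if d < i then j - i + 2 * d
  else if d <= n - j then i + j
  else if d <= n - j + i then j - i + 2 * (n - j + i - d)
  else j - i.
Proof.
move=> ij ijn dn.
have E a b c e : a <= b <= c -> c <= e <= n ->
  (forall k, k < n -> (in_arc 0 i k != in_arc d j k) =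
     ((a <= k < b) || (c <= k < e))) -> arc_dist 0 i d j = b - a + (e - c).
  move=> abc cen h; rewrite /arc_dist.
  under eq_bigr => k _ do rewrite h //.
  by rewrite sum_two_intervals //; lia.
have S k : k < n -> (in_arc 0 i k != in_arc d j k) =
  ((k < i) != (if d <= k then k - d < j else k + n - d < j)).
  by move=> kn; rewrite !in_arc_small //; [rewrite subn0|lia].
case: ifP => [di|di].
  by rewrite (E 0 d i (d + j)); [lia|lia|lia|move=> k kn; rewrite S //; case: ifP; lia].
case: ifP => dj.
  by rewrite (E 0 i d (d + j)); [lia|lia|lia|move=> k kn; rewrite S //; case: ifP; lia].
case: ifP => dij.
  by rewrite (E (d + j - n) i d n); [lia|lia|lia|move=> k kn; rewrite S //; case: ifP; lia].
by rewrite (E i (d + j - n) d n); [lia|lia|lia|move=> k kn; rewrite S //; case: ifP; lia].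
Qed.

Lemma arc_dist_nil x y j : 1 <= y <= n -> j <= n -> arc_dist x 0 y j = j.
Proof.
move=> hy jn; rewrite /arc_dist.
rewrite -(@sum_periodic (fun k => in_arc x 0 k != in_arc y j k) y); last first.
  by move=> k; rewrite !in_arcDn.
rewrite (eq_bigr (fun k : 'I_n => nat_of_bool (k < j))).
  (* The second interval is empty; it is added to fit [sum_two_intervals]. *)
  rewrite (eq_bigr (fun k : 'I_n => nat_of_bool ((0 <= k < j) || (j <= k < j)))).
    by rewrite sum_two_intervals; lia.
  by move=> k _; congr nat_of_bool; lia.
move=> k _; rewrite addnC in_arcDl //; last lia.
by rewrite /in_arc ltn0; case: (_ < j).
Qed.

End CyclicArcs.

(** * Entries of the block form *)

Section BlockFormEntries.
Variables (K : comNzRingType) (q : K) (n : nat).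
Local Open Scope nat_scope.

Lemma nth_rotr (s : seq K) i j : i < size s -> j < size s ->
  ((rotr i s)`_j = s`_((j + size s - i) %% size s))%R.
Proof.
move=> is_ js; rewrite /rotr /rot nth_cat size_drop nth_drop.
have -> : size s - (size s - i) = i by lia.
case: ltnP => ji; first by rewrite modn_small; [congr nth|]; lia.
rewrite nth_take; last lia.
by rewrite (_ : j + size s - i = j - i + size s) ?modnDr ?modn_small //; lia.
Qed.

Lemma nth_first_row i j d : 1 <= i <= j -> i + j <= n + 1 -> d < n ->
  ((first_row q n i j)`_d = q ^+ arc_dist n 0 i d j)%R.
Proof.
move=> ij ijn dn; rewrite arc_dist0E // /first_row.
rewrite nth_cat size_map size_iota; case: ifP => di.
  by rewrite (nth_map 0) ?size_iota // nth_iota.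
rewrite nth_cat size_nseq nth_nseq; case: ifP => d1.
  by rewrite d1; have -> : (d <= n - j) = true by lia.
have -> : (d <= n - j) = false by lia.
rewrite nth_cat size_map size_rev size_iota; case: ifP => d2.
  have -> : (d <= n - j + i) = true by lia.
  rewrite (nth_map 0) ?size_rev ?size_iota // nth_rev ?size_iota // nth_iota; last lia.
  by congr (q ^+ _)%R; lia.
rewrite nth_nseq ifT; last lia.
(* At d = n - j + i the entry is already in the last group, while [arc_dist0E] is still in its third
   case; both exponents are j - i. *)
by case: ifP => // h; congr (q ^+ _)%R; lia.
Qed.

(** Row x of a circulant is the first row rotated x times, so its entry in column y is found at y -
    x modulo n, the offset between the two arcs. Below the diagonal the transpose is absorbed by the
    symmetry of [arc_dist]. *)
Lemma block_CE i j (x y : 'I_n) : 1 <= i -> 1 <= j -> i + j <= n + 1 ->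
  (block_C q n i j x y = q ^+ arc_dist n x.+1 i y.+1 j)%R.
Proof.
have E a b (u v : 'I_n) : 1 <= a <= b -> a + b <= n + 1 ->
    (circulant n (first_row q n a b) u v = q ^+ arc_dist n u.+1 a v.+1 b)%R.
  move=> ab abn; have [un vn] := (ltn_ord u, ltn_ord v).
  rewrite mxE nth_rotr size_first_row // nth_first_row ?ltn_mod //; last lia.
  by rewrite -(@arc_dist_shift n u.+1 a v.+1 b) //; congr (_ %% _); lia.
move=> i1 j1 ijn; rewrite /block_C; case: leqP => ij; first by rewrite E // i1.
by rewrite mxE arc_distC E //; lia.
Qed.

(* The pair (r, x) such that l = (r - 1) * n + x and 1 <= x <= n; the interior
   of the polygon, l = 0, gets r = 0 and so the empty arc. *)
Definition region_size (l : nat) := (l + n - 1) %/ n.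
Definition region_start (l : nat) := ((l + n - 1) %% n).+1.

(** Blocks r and offsets x count from 0 here, as the indices of [\mxrow] and [\mxblock] do. *)
Lemma region_indexS r x : x < n ->
  (region_size (1 + (r * n + x)) = r.+1) * (region_start (1 + (r * n + x)) = x.+1).
Proof.
move=> xn; rewrite /region_size /region_start.
rewrite (_ : 1 + _ + n - 1 = r.+1 * n + x); last lia.
have n0 : 0 < n by lia.
by rewrite divnMDl // divn_small // addn0 modnMDl modn_small.
Qed.

Lemma region_size0 : 0 < n -> region_size 0 = 0.
Proof. by move=> n0; rewrite /region_size divn_small; lia. Qed.

Lemma block_formE p (a b : 'I_(1 + n * p)) : 2 * p <= n + 1 -> 0 < n ->
  (block_form q n p a b = q ^+
    arc_dist n (region_start a) (region_size a) (region_start b) (region_size b))%R.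
Proof.
move=> pn n0; rewrite castmxE.
set a' := cast_ord _ a; set b' := cast_ord _ b.
have [-> ->] : (a = a' :> nat) /\ (b = b' :> nat) by [].
have ple (k : 'I_p) : k.+1 <= n by have := ltn_ord k; lia.
(* A position in the concatenated blocks consists of r full blocks of length n and an offset x; the
   shift by 1 skips the polygon interior. *)
have idx (i : 'I_(\sum_(r < p) n)) : exists r (x : 'I_n), [/\ tagnat.sig1 i = r,
    tagnat.sig2 i = x :> nat & rshift 1 i = 1 + (r * n + x) :> nat].
  exists (tagnat.sig1 i), (tagnat.sig2 i); split => //=.
  rewrite {1}[i : nat]tagnat.rect; congr (_ + (_ + _)).
  rewrite -(big_ord_widen p (fun=> n)); last exact: ltnW.
  by rewrite sum_nat_const card_ord.
case: (split_ordP a') => [i|i] ->; case: (split_ordP b') => [j|j] ->.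
- rewrite block_mxEul !ord1 mxE /= region_size0 // arc_dist_nil ?expr0 //=.
  by rewrite /region_start ltn_mod n0.
- rewrite block_mxEur !ord1; have [r [x [r_ x_ ->]]] := idx j.
  rewrite !mxE !region_indexS // [region_size (lshift _ _)]region_size0 // arc_dist_nil ?r_ //.
  by rewrite /= ltn_ord.
- rewrite block_mxEdl !ord1; have [r [x [r_ x_ ->]]] := idx i.
  rewrite !mxE !region_indexS // [region_size (lshift _ _)]region_size0 // arc_distC.
  rewrite arc_dist_nil ?r_ //.
  by rewrite /= ltn_ord.
- rewrite block_mxEdr; have [r [x [r_ x_ ->]]] := idx i.
  have [r' [x' [r'_ x'_ ->]]] := idx j.
  have [? ?] := (ltn_ord r, ltn_ord r').
  rewrite mxE !region_indexS // r_ r'_.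
  rewrite block_CE //; last lia.
  by rewrite x_ x'_.
Qed.
End BlockFormEntries.

(** * Recovering a nonempty arc and its index *)

Section ArcInjectivity.
Local Open Scope nat_scope.
Variable n : nat.

(** Of the four values in [arc_dist0E] only the first can vanish, at d = 0 and i = j, because d < n.
    Empty arcs are excluded since they do not determine their start. *)
Lemma arc_dist_eq0 x i y j : 1 <= x <= n -> 1 <= y <= n -> i + j <= n + 1 ->
  1 <= i -> 1 <= j -> arc_dist n x i y j = 0 -> x = y /\ i = j.
Proof.
have W u a v b : 1 <= u <= n -> 1 <= v <= n -> a + b <= n + 1 -> 1 <= a <= b ->
    arc_dist n u a v b = 0 -> u = v /\ a = b.
  move=> hu hv abn ab; rewrite (arc_dist_shift _ _ hu hv erefl).
  have n0 : 0 < n by lia.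
  rewrite arc_dist0E ?ltn_pmod //; have := ltn_pmod (v + n - u) n0.
  case: (leqP u v) => uv.
    rewrite (_ : (v + n - u) %% n = v - u); last first.
      by rewrite (_ : v + n - u = v - u + n) ?modnDr ?modn_small //; lia.
    by case: ifP => ?; last case: ifP => ?; last case: ifP => ?; lia.
  rewrite modn_small; last lia.
  by case: ifP => ?; last case: ifP => ?; last case: ifP => ?; lia.
move=> hx hy ijn i1 j1; case: (leqP i j) => ij h; first by apply: W => //; rewrite i1.
by rewrite arc_distC in h; have [] := W y j x i hy hx _ _ h; [lia|lia|move=> -> ->].
Qed.

Lemma region_indexP p l : l < 1 + n * p ->
  l = 0 \/ exists r x, [/\ r < p, x < n & l = 1 + (r * n + x)].
Proof.
case: l => [|l]; first by left.
rewrite ltnS => lnp; have n0 : 0 < n by lia.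
right; exists (l %/ n), (l %% n); split; last by rewrite -divn_eq.
  by rewrite ltn_divLR // mulnC.
by rewrite ltn_mod.
Qed.

Lemma region_start_bounds l : 0 < n -> 1 <= region_start n l <= n.
Proof. by move=> n0; rewrite /region_start /= ltn_mod. Qed.

Lemma region_size_le p l : 0 < n -> l < 1 + n * p -> region_size n l <= p.
Proof.
move=> n0 /region_indexP [->|[r [x [rp xn ->]]]]; first by rewrite region_size0.
by rewrite region_indexS.
Qed.

End ArcInjectivity.

(** * Unit vectors and polar coordinates *)

Section Trigonometry.
Variable R : realType.
Implicit Types x a : R.

Lemma ler_cos_pi x a : 0 <= x <= pi -> 0 <= a <= pi -> (cos x <= cos a) = (a <= x).
Proof. by move=> hx ha; rewrite leNgt ltr_cos ?in_itv //= -leNgt. Qed.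

Lemma cos_lt_near x a : `|x| < a -> a <= pi -> cos a < cos x.
Proof.
move=> xa api; have x0 := normr_ge0 x.
by rewrite -(cos_norm x) ltr_cos ?in_itv //=; apply/andP; split; lra.
Qed.

Lemma cos_2piB x : cos (2 * pi - x) = cos x.
Proof.
by rewrite cosB (_ : 2 * pi = pi *+ 2) ?cos2pi ?sin2pi; [ring|rewrite mulr_natl].
Qed.

Lemma cos_le_far x a : 0 <= a -> a <= x <= 2 * pi - a -> cos x <= cos a.
Proof.
move=> a0 /andP[ax xa]; have [xpi|pix] := leP x pi.
  by rewrite ler_cos_pi //; apply/andP; split; lra.
by rewrite -cos_2piB ler_cos_pi; [|apply/andP; split..]; lra.
Qed.

Lemma cos_lt_far x a : 0 <= a -> a < x < 2 * pi - a -> cos x < cos a.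
Proof.
move=> a0 /andP[ax xa]; have [xpi|pix] := leP x pi.
  by rewrite ltr_cos ?in_itv //=; apply/andP; split; lra.
by rewrite -cos_2piB ltr_cos ?in_itv /=; [|apply/andP; split..]; lra.
Qed.

Lemma cosD2piz x (m : int) : cos (x + 2 * pi * m%:~R) = cos x.
Proof.
have N (y : R) (k : nat) : cos (y + 2 * pi * k%:R) = cos y.
  have -> : 2 * pi * k%:R = (pi *+ 2) *+ k :> R by rewrite -[RHS]mulr_natr; ring.
  exact: (periodicn (@cosD2pi R)).
case: m => k; first exact: N.
by rewrite NegzE -(N _ k.+1) mulrNz mulrN subrK.
Qed.

Lemma sinD2piz x (m : int) : sin (x + 2 * pi * m%:~R) = sin x.
Proof.
by rewrite -!cosBpihalf -[in RHS](cosD2piz _ m); congr cos; ring.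
Qed.

Definition dir (a : R) : 'rV[R]_2 := \row_(j < 2) (if j == 0 then cos a else sin a).

Lemma dotrvE (u v : 'rV[R]_2) : dotrv u v = u 0 0 * v 0 0 + u 0 1 * v 0 1.
Proof.
rewrite /dotrv !big_ord_recl big_ord0 addr0; congr (_ + _ * _);
  by congr fun_of_matrix; apply: val_inj.
Qed.

Lemma rV2P (u v : 'rV[R]_2) : u 0 0 = v 0 0 -> u 0 1 = v 0 1 -> u = v.
Proof.
move=> h0 h1; apply/rowP => -[[|[|//]] h].
  by rewrite (_ : Ordinal h = 0) //; apply: val_inj.
by rewrite (_ : Ordinal h = 1) //; apply: val_inj.
Qed.

Lemma dir0E a : dir a 0 0 = cos a. Proof. by rewrite mxE. Qed.
Lemma dir1E a : dir a 0 1 = sin a. Proof. by rewrite mxE. Qed.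

Lemma dotrv_dir a b : dotrv (dir a) (dir b) = cos (a - b).
Proof. by rewrite dotrvE !dir0E !dir1E cosB. Qed.

Lemma dirD2piz a m : dir (a + 2 * pi * m%:~R) = dir a.
Proof. by apply: rV2P; rewrite ?dir0E ?dir1E ?cosD2piz ?sinD2piz. Qed.

Lemma dotrvDr (u v w : 'rV[R]_2) : dotrv u (v + w) = dotrv u v + dotrv u w.
Proof. by rewrite !dotrvE !mxE; ring. Qed.

Lemma dotrvBr (u v w : 'rV[R]_2) : dotrv u (v - w) = dotrv u v - dotrv u w.
Proof. by rewrite !dotrvE !mxE; ring. Qed.

Lemma dotrvZr t (u v : 'rV[R]_2) : dotrv u (t *: v) = t * dotrv u v.
Proof. by rewrite !dotrvE !mxE; ring. Qed.

Lemma dotrvNl (u v : 'rV[R]_2) : dotrv (- u) v = - dotrv u v.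
Proof. by rewrite !dotrvE !mxE; ring. Qed.

Lemma dir_frame a v : v = dotrv (dir a) v *: dir a +
  dotrv (dir (a + pi / 2)) v *: dir (a + pi / 2).
Proof.
have := cos2Dsin2 a; rewrite !expr2 => h.
apply: rV2P; rewrite !dotrvE !mxE /= cosDpihalf sinDpihalf.
  rewrite -[LHS]mul1r -h; ring.
rewrite -[LHS]mul1r -h; ring.
Qed.

Lemma dirD a b : dir (a + b) = cos b *: dir a + sin b *: dir (a + pi / 2).
Proof.
apply: rV2P; rewrite !mxE /= ?cosDpihalf ?sinDpihalf ?cosD ?sinD; ring.
Qed.

(** For 0 <= b <= d < pi both coefficients on the right are nonnegative, so a point of a sector
    becomes a nonnegative combination of the directions bounding it. *)
Lemma dir_sector a b d : sin d *: dir (a + b) = sin (d - b) *: dir a + sin b *: dir (a + d).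
Proof.
rewrite (dirD a b) (dirD a d) !scalerDr !scalerA sinB addrA -scalerDl.
by congr (_ *: _ + _ *: _); ring.
Qed.

Lemma polar v : exists s a, 0 <= s /\ v = s *: dir a.
Proof.
set s := Num.sqrt (v 0 0 ^+ 2 + v 0 1 ^+ 2).
have s0 : 0 <= s by apply: sqrtr_ge0.
have ss : s ^+ 2 = v 0 0 ^+ 2 + v 0 1 ^+ 2.
  by rewrite sqr_sqrtr // addr_ge0 // sqr_ge0.
have [z|nz] := eqVneq s 0.
  exists 0, 0; split => //; rewrite scale0r.
  move: ss; rewrite z expr0n /= => /esym/eqP.
  rewrite paddr_eq0 ?sqr_ge0 // !sqrf_eq0 => /andP[/eqP h0 /eqP h1].
  by apply: rV2P; rewrite ?h0 ?h1 mxE.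
have sp : 0 < s by rewrite lt_def nz.
pose u := v 0 0 / s.
have u1 : u ^+ 2 <= 1.
  by rewrite /u expr_div_n ler_pdivrMr ?exprn_gt0 // ss mul1r lerDl sqr_ge0.
have hu : -1 <= u <= 1 by move: u1; rewrite expr2 => u1; apply/andP; split; nra.
have sqE : Num.sqrt (1 - u ^+ 2) = `|v 0 1| / s.
  rewrite -[RHS]ger0_norm ?divr_ge0 // -sqrtr_sqr; congr Num.sqrt.
  rewrite /u !expr_div_n real_normK ?num_real // -(divff (expf_neq0 2 nz)) {1}ss.
  by field.
have cu : s * cos (acos u) = v 0 0 by rewrite acosK ?in_itv //= /u mulrC divfK.
(* The arccosine yields angles in [0, pi]; the lower half-plane is reached by reflection. *)
have [v1|v1] := leP 0 (v 0 1).
  exists s, (acos u); split => //; apply: rV2P; rewrite mxE ?dir0E ?dir1E ?cu //.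
  by rewrite sin_acos // sqE ger0_norm // mulrC divfK.
exists s, (- acos u); split => //; apply: rV2P; rewrite mxE ?dir0E ?dir1E ?cosN ?cu //.
by rewrite sinN sin_acos // sqE ltr0_norm // mulNr opprK mulrC divfK.
Qed.

End Trigonometry.

(** * Caps of equally spaced directions *)

Section CosineOnLattice.
Variables (R : realType) (n : nat).
Hypothesis n_ge3 : (3 <= n)%N.

Definition angle_step : R := 2 * pi / n%:R.
Local Notation step := angle_step.

Lemma nR_ge3 : 3 <= n%:R :> R.
Proof. by rewrite (ler_nat _ 3). Qed.

Lemma nR_neq0 : n%:R != 0 :> R.
Proof. by rewrite pnatr_eq0; case: n n_ge3. Qed.

Lemma step_gt0 : 0 < step.
Proof. by rewrite divr_gt0 ?mulr_gt0 ?pi_gt0 //; have := nR_ge3; lra. Qed.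

Lemma step_n : step * n%:R = 2 * pi.
Proof. by rewrite /angle_step divfK // nR_neq0. Qed.

(** The offset of k in an arc starting at x replaces k - x, since n steps make a full turn. This
    lets [in_arc] be compared with cosines. *)
Lemma cos_step_shift (k x : nat) (z : R) : (x <= n)%N ->
  cos (step * (k%:R - z)) = cos (step * (x%:R + ((k + (n - x)) %% n)%:R - z)).
Proof.
move=> xn; set j := (_ %% n)%N; set Q := ((k + (n - x)) %/ n)%N.
have : (k + n = Q * n + j + x)%N by rewrite /Q /j -divn_eq; lia.
move=> /(congr1 (fun m => m%:R : R)); rewrite !natrD natrM => h.
(* The quotient is lowered by 1 because n - x was added in place of - x. *)
rewrite -(cosD2piz (step * (x%:R + j%:R - z)) (Q%:Z - 1)).
congr cos; rewrite -step_n rmorphB /= -pmulrn.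
have -> : k%:R = Q%:R * n%:R + j%:R + x%:R - n%:R :> R by lra.
by rewrite mulr1z; ring.
Qed.

Lemma cos_near_lattice (b e : R) : 0 < b -> step * b < pi / 2 ->
  - b < e < b -> cos (step * b) < cos (step * e).
Proof.
move=> b0 bpi /andP[e1 e2]; have s0 := step_gt0; have := pi_gt0 R => pi0.
apply: cos_lt_near; last lra.
by rewrite ltr_norml -mulrN !ltr_pM2l // e1.
Qed.

Lemma cos_far_lattice (b e : R) : 0 < b -> b <= e <= n%:R - b ->
  cos (step * e) <= cos (step * b).
Proof.
move=> b0 /andP[e1 e2]; have s0 := step_gt0.
apply: cos_le_far; first by apply: mulr_ge0; lra.
by rewrite -step_n -mulrBr !ler_pM2l // e1.
Qed.

Lemma cos_sfar_lattice (b e : R) : 0 < b -> b < e < n%:R - b ->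
  cos (step * e) < cos (step * b).
Proof.
move=> b0 /andP[e1 e2]; have s0 := step_gt0.
apply: cos_lt_far; first by apply: mulr_ge0; lra.
by rewrite -step_n -mulrBr !ltr_pM2l // e1.
Qed.

Lemma step_quarter b : (step * b < pi / 2) = (4 * b < n%:R).
Proof.
have := pi_gt0 R => pi0; have := nR_ge3 => n3.
rewrite /angle_step mulrAC ltr_pdivrMr; last lra.
by apply/idP/idP => h; nra.
Qed.

(** Euclidean division of the floor of z by n: Q counts full turns and w whole steps. *)
Lemma real_mod_lattice (z : R) : exists (Q : int) (w : nat),
  (w < n)%N /\ w%:R <= z - Q%:~R * n%:R < w%:R + 1.
Proof.
have n0 : (0 < n)%N by lia.
set f := Num.floor z; pose Q := (f %/ n%:Z)%Z.
have [w wE] : exists w : nat, (f %% n%:Z)%Z = w.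
  by exists `|(f %% n%:Z)%Z|%N; rewrite gez0_abs // modz_ge0 //; lia.
exists Q, w; split; first by rewrite -ltz_nat -wE ltz_pmod.
have := floor_itv z; rewrite -/f rmorphD /= (divz_eq f n%:Z) wE -/Q rmorphD rmorphM /=.
by rewrite -!pmulrn mulr1n => /andP[f1 f2]; apply/andP; split; lra.
Qed.

(** Modulo n, the indices in the cap are the integers strictly between y - b and y + b, where y is z
    reduced by full turns. They start at w + 1, with w the floor of y - b, and stop before N, the
    ceiling of y + b. As 4 b < n, their number r satisfies r < 2 b + 1, whence 2 r < n + 2. *)
Lemma cap_is_arc (z b : R) : 0 < b -> step * b < pi / 2 ->
  exists x r, [/\ (1 <= x <= n)%N, (2 * r <= n + 1)%N &
    forall k : nat, (cos (step * b) < cos (step * (k%:R - z))) = in_arc n x r k].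
Proof.
move=> b0 bq; have hb : 4 * b < n%:R by rewrite -step_quarter.
have [Q [w [wn /andP[w1 w2]]]] := real_mod_lattice (z - b).
pose y := z - Q%:~R * n%:R.
have [y1 y2] : w%:R <= y - b /\ y - b < w%:R + 1 by rewrite /y; split; lra.
pose N := `|Num.ceil (y + b)|%N.
have NE (m : nat) : (m < N)%N = (m%:R < y + b).
  rewrite -ltz_nat gez0_abs ?ceil_gt_int //.
  by rewrite ceil_ge0; have := ler0n R w; lra.
exists w.+1, (N - w.+1)%N; split => //.
- case: (leqP N w.+1) => hN; first lia.
  have : (N.-1 < N)%N by lia.
  rewrite NE => hN1.
  have : (2 * (N.-1)%:R < n%:R + 2 * (w.+1)%:R :> R) by rewrite -[w.+1%:R]natr1; lra.
  by rewrite -!natrM -natrD ltr_nat; lia.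
move=> k; rewrite (_ : cos (step * (k%:R - z)) = cos (step * (k%:R - y))); last first.
  rewrite -[in RHS](cosD2piz _ (- Q)) -step_n /y; congr cos.
  by rewrite rmorphN /=; ring.
rewrite (@cos_step_shift k w.+1) // /in_arc.
set j := (_ %% n)%N; have jn : (j < n)%N by rewrite ltn_mod; lia.
have jn' : j%:R + 1 <= n%:R :> R by rewrite natr1 ler_nat.
(* Shifted by a multiple of n, k - z lies in ]-b, n - b], where the cosine
   exceeds cos (step * b) exactly on ]-b, b[. *)
rewrite -natrD ltn_subRL NE natrD -[w.+1%:R]natr1.
have j0 := ler0n R j.
have [h|h] := ltP (w%:R + 1 + j%:R) (y + b);
  first by rewrite cos_near_lattice //; apply/andP; split; lra.
by apply/negbTE; rewrite -leNgt cos_far_lattice //; apply/andP; split; lra.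
Qed.

Lemma arc_is_cap (x r : nat) : (1 <= x <= n)%N -> (1 <= r)%N -> (2 * r <= n + 1)%N ->
  exists z b, [/\ 0 < b, step * b < pi / 2 &
    forall k : nat, cos (step * (k%:R - z)) != cos (step * b) /\
      (cos (step * b) < cos (step * (k%:R - z))) = in_arc n x r k].
Proof.
move=> hx r1 rn.
have rR : 1 <= r%:R :> R by rewrite (ler_nat _ 1).
have rnR : 2 * r%:R <= n%:R + 1 :> R by rewrite -natrM natr1 ler_nat; lia.
have n3 := nR_ge3.
(* The cap is centred at the midpoint of x, ..., x + r - 1. The margin 1 / 8 keeps lattice points
   off its boundary; being below 1 / 4, it also keeps 4 b below n. *)
exists (x%:R + (r%:R - 1) / 2), ((r%:R - 1) / 2 + 1 / 8); split; [lra| |].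
  rewrite step_quarter.
  have : 2 * r%:R <= n%:R + 1 :> R by [].
  lra.
move=> k; rewrite (@cos_step_shift k x); last lia.
rewrite /in_arc; set j := (_ %% n)%N; have jn : (j < n)%N by rewrite ltn_mod; lia.
have jn' : j%:R + 1 <= n%:R :> R by rewrite natr1 ler_nat.
have j0 := ler0n R j.
have [jr|rj] := ltnP j r.
  have jr' : j%:R + 1 <= r%:R :> R by rewrite natr1 ler_nat.
  set u := cos _; set v := cos _; have : v < u; last by move=> h; rewrite h gt_eqF.
  apply: cos_near_lattice; rewrite ?step_quarter; [lra|lra|apply/andP; split; lra].
have rj' : r%:R <= j%:R :> R by rewrite ler_nat.
set u := cos _; set v := cos _; have : u < v; last by move=> uv; rewrite lt_eqF // ltNge ltW.
by apply: cos_sfar_lattice; [lra|apply/andP; split; lra].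
Qed.

(** A half-integer number of steps is at least half a step away from every full turn. Hence all
    vertices lie on the inner side of every edge line. *)
Lemma cos_half_step (k i : nat) :
  cos (step * (k%:R + 2^-1 - i%:R)) <= cos (step * 2^-1).
Proof.
have n3 := nR_ge3.
have -> : k%:R + 2^-1 - i%:R = k%:R - (i%:R - 2^-1) :> R by ring.
have n0 : (0 < n)%N by lia.
have E : cos (step * (k%:R - (i%:R - 2^-1))) = cos (step * (k%:R - ((i %% n)%:R - 2^-1))).
  rewrite -[in LHS](cosD2piz _ (i %/ n)%N) -step_n.
  have /(congr1 (fun m => m%:R : R)) := divn_eq i n; rewrite natrD natrM => {1}->.
  by congr cos; rewrite -pmulrn; ring.
rewrite E (@cos_step_shift k (i %% n)); last by apply: ltnW; rewrite ltn_mod.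
set j := ((k + _) %% n)%N; have jn : (j < n)%N by rewrite ltn_mod.
have jn' : j%:R + 1 <= n%:R :> R by rewrite natr1 ler_nat.
have j0 := ler0n R j.
have -> : (i %% n)%:R + j%:R - ((i %% n)%:R - 2^-1) = j%:R + 2^-1 :> R by ring.
by apply: cos_far_lattice; [lra|apply/andP; split; lra].
Qed.

End CosineOnLattice.

(** * Edge lines and sign cells *)

Section CyclicModelGeometry.
Variables (R : realType) (n : nat) (c : 'rV[R]_2) (rho theta : R).
Hypotheses (n_ge3 : (3 <= n)%N) (rho_gt0 : 0 < rho).
Implicit Types x y : 'rV[R]_2.

Local Notation step := (angle_step R n).
Local Notation vertex := (vertex n c rho theta).
Local Notation edge_line := (edge_line n c rho theta).
Local Notation model := (cyclic_model n c rho theta).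

(** The outward unit normal of edge k, which bisects the directions of vertices k and k + 1. *)
Definition normal (k : nat) : 'rV[R]_2 := dir (theta + step * (k%:R + 2^-1)).

(* Positive on the side of the k-th edge line that contains the centre c. *)
Definition edge_gap (k : nat) y : R :=
  rho * cos (step * 2^-1) - dotrv (normal k) (y - c).
Local Notation gap := edge_gap.

Lemma half_step_bounds : 0 < step * 2^-1 < pi / 2.
Proof.
apply/andP; split; first by rewrite mulr_gt0 ?step_gt0.
by rewrite step_quarter //; have := nR_ge3 R n_ge3; lra.
Qed.

Lemma cos_half_step_gt0 : 0 < cos (step * 2^-1).
Proof.
have := half_step_bounds; have := pi_gt0 R => ? /andP[? ?].
by apply: cos_gt0_pihalf; apply/andP; split; lra.
Qed.

Lemma sin_half_step_gt0 : 0 < sin (step * 2^-1).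
Proof.
have := half_step_bounds; have := pi_gt0 R => ? /andP[? ?].
by apply: sin_gt0_pi; apply/andP; split; lra.
Qed.

Lemma gap_segment k x y t :
  gap k (x + t *: (y - x)) = (1 - t) * gap k x + t * gap k y.
Proof. by rewrite /edge_gap !(dotrvBr, dotrvDr, dotrvZr); ring. Qed.

Lemma gap_polar k s a : gap k (c + s *: dir a) =
  rho * cos (step * 2^-1) - s * cos (theta + step * (k%:R + 2^-1) - a).
Proof. by rewrite /edge_gap /normal (addrC c) addrK dotrvZr dotrv_dir. Qed.

Lemma gap_centre k : gap k c = rho * cos (step * 2^-1).
Proof. by have := gap_polar k 0 0; rewrite scale0r addr0 mul0r subr0. Qed.

Lemma gap_centre_gt0 k : 0 < gap k c.
Proof. by rewrite gap_centre mulr_gt0 // cos_half_step_gt0. Qed.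

Lemma vertexE k : vertex k = c + rho *: dir (theta + step * k%:R).
Proof. by rewrite /Defs.vertex /angle_step (mulrAC (2 * pi)). Qed.

Lemma gap_vertex k i : gap k (vertex i) =
  rho * (cos (step * 2^-1) - cos (step * (k%:R + 2^-1 - i%:R))).
Proof.
by rewrite vertexE gap_polar mulrBr; congr (_ - _ * cos _); ring.
Qed.

Lemma gap_vertex_ge0 k i : 0 <= gap k (vertex i).
Proof. by rewrite gap_vertex mulr_ge0 ?subr_ge0 ?cos_half_step // ltW. Qed.

Lemma gap_vertex_id k : gap k (vertex k) = 0.
Proof. by rewrite gap_vertex [k%:R + _]addrC addrK subrr mulr0. Qed.

Lemma gap_vertexS k : gap k (vertex k.+1) = 0.
Proof.
rewrite gap_vertex -[k.+1%:R]natr1 -[cos (step * 2^-1)]cosN.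
by rewrite (_ : step * (k%:R + 2^-1 - (k%:R + 1)) = - (step * 2^-1)) ?subrr ?mulr0 //; field.
Qed.

Lemma edge_lineE k : edge_line k = [set y | gap k y = 0].
Proof.
apply/seteqP; split => [_ [t _ <-]|y] /=.
  by rewrite gap_segment gap_vertex_id gap_vertexS !mulr0 addr0.
move=> gy; have s0 := sin_half_step_gt0.
set a := theta + step * (k%:R + 2^-1); set h := step * 2^-1.
pose m := dotrv (dir (a + pi / 2)) (y - c).
(* The coordinate m along the edge runs from - rho sin h at vertex k to rho sin h at vertex k + 1;
   it is rescaled to [0, 1]. *)
exists ((m / (rho * sin h) + 1) / 2) => //.
have yE : y = c + (rho * cos h) *: dir a + m *: dir (a + pi / 2).
  have := dir_frame a (y - c); rewrite -/m (_ : dotrv _ _ = rho * cos h).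
    by move=> e; rewrite -addrA -e addrC subrK.
  by apply/eqP; rewrite eq_sym -subr_eq0; apply/eqP.
rewrite !vertexE (_ : theta + step * k%:R = a + - h); last by rewrite /a /h; ring.
rewrite (_ : theta + step * k.+1%:R = a + h); last by rewrite /a /h -[k.+1%:R]natr1; field.
rewrite (dirD a (- h)) (dirD a h) cosN sinN [in RHS]yE.
by apply: rV2P; rewrite !mxE; field; rewrite !gt_eqF.
Qed.

Lemma gap_period k (m : nat) y : gap (k + m * n) y = gap k y.
Proof.
rewrite /edge_gap /normal; congr (_ - dotrv _ _).
rewrite -[RHS](dirD2piz _ m) -(step_n R n_ge3) natrD natrM -pmulrn.
by congr dir; ring.
Qed.

Lemma gap_mod k y : gap (k %% n) y = gap k y.
Proof. by rewrite [in RHS](divn_eq k n) addnC gap_period. Qed.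

Lemma edge_line_mod k : edge_line (k %% n) = edge_line k.
Proof. by rewrite !edge_lineE; apply/seteqP; split => y /=; rewrite gap_mod. Qed.

Lemma cyclic_modelE : model = range edge_line.
Proof.
apply/seteqP; split => _ [k hk <-]; first by exists k.
(* The lines of the model are numbered from 1 to n, so n represents the residue 0. *)
exists (if k %% n == 0 then n else k %% n)%N.
  by case: eqP => /=; have := ltn_pmod k (_ : 0 < n)%N; lia.
by rewrite -[RHS]edge_line_mod; case: eqP => // ->; rewrite -edge_line_mod modnn.
Qed.

Lemma complementP y : arr_complement model y <-> forall k, gap k y != 0.
Proof.
rewrite cyclic_modelE; split => [h k|h [_ [k _ <-]]].
  by apply/negP => /eqP g0; apply: h; exists (edge_line k); [exists k|rewrite edge_lineE].
by rewrite edge_lineE /= => /eqP; apply/negP/h.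
Qed.

Lemma gap_continuous k : continuous (gap k).
Proof.
have -> : gap k = fun y => rho * cos (step * 2^-1) -
    (normal k 0 0 * (y 0 0 - c 0 0) + normal k 0 1 * (y 0 1 - c 0 1)).
  by apply/funext => x; rewrite /edge_gap dotrvE !mxE.
have E i (y : 'rV[R]_2) : (normal k 0 i * (x 0 i - c 0 i)) @[x --> y] -->
    normal k 0 i * (y 0 i - c 0 i).
  by apply: cvgMl_tmp; apply: cvgB; [exact: coord_continuous|exact: cvg_cst].
by move=> y; apply: (cvgB (cvg_cst _) (cvgD (E 0 y) (E 1 y))).
Qed.

(** The function s marks the lines that separate the cell from the centre. As k ranges over all
    naturals, s is n-periodic whenever the cell is nonempty. *)
Definition sign_cell (s : nat -> bool) : set 'rV[R]_2 :=
  [set y | forall k, gap k y != 0 /\ (gap k y < 0) = s k].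
Local Notation cell := sign_cell.

Lemma segment_sub_cell s x y t : 0 <= t <= 1 -> cell s x -> cell s y ->
  cell s (x + t *: (y - x)).
Proof.
move=> /andP[t0 t1] sx sy k; rewrite gap_segment.
have [[x0 xs] [y0 ys]] := (sx k, sy k); rewrite -xs.
have [xlt|xge] := ltP (gap k x) 0.
  have ylt : gap k y < 0 by rewrite ys -xs xlt.
  set g := _ + _; have : g < 0 by rewrite /g; nra.
  by move=> g0; rewrite g0 lt_eqF.
have xgt : 0 < gap k x by rewrite lt_def x0.
have ygt : 0 < gap k y by rewrite lt_def y0 leNgt ys -xs -leNgt.
set g := _ + _; have : 0 < g by rewrite /g; nra.
by move=> g0; rewrite gt_eqF // ltNge ltW.
Qed.

Lemma segment_connected_rV x y : connected [set x + t *: (y - x) | t in `[(0:R), 1]].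
Proof.
apply: connected_continuous_connected; first exact: segment_connected.
apply: continuous_subspaceT => t.
by apply: cvgD; [exact: cvg_cst|apply: cvgZr_tmp; exact: cvg_id].
Qed.

(** On a connected subset of the complement, the values of each gap form an interval that avoids 0,
    so its sign is constant. Conversely, segments from y stay inside the cell and are connected. *)
Lemma component_cell s y : cell s y -> connected_component (arr_complement model) y = cell s.
Proof.
move=> sy; apply/seteqP; split => z.
  move=> [C [Cy CA Cc] Cz] k; have z0 := (complementP z).1 (CA _ Cz) k.
  split => //; have [y0 <-] := sy k.
  have : is_interval (gap k @` C).
    apply/connected_intervalP/connected_continuous_connected => //.
    by apply: continuous_subspaceT; exact: gap_continuous.
  move=> itv.
  have N x x' : C x -> C x' -> gap k x < 0 -> gap k x' < 0.
    move=> Cx Cx' xlt; rewrite ltNge; apply/negP => xge.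
    have [w Cw /eqP] : (gap k @` C) 0.
      by apply: (itv (gap k x) (gap k x')); [exists x|exists x'|rewrite (ltW xlt)].
    by apply/negP/(complementP w).1/CA.
  by apply/idP/idP; apply: N.
move=> sz; exists [set y + t *: (z - y) | t in `[(0:R), 1]].
  split; last exact: segment_connected_rV.
    by exists 0; rewrite /= ?in_itv /= ?lexx ?ler01 // scale0r addr0.
  move=> _ [t /= + <-]; rewrite in_itv /= => t01.
  by apply/complementP => k; have [] := segment_sub_cell t01 sy sz k.
by exists 1; rewrite /= ?in_itv /= ?lexx ?ler01 // scale1r addrC subrK.
Qed.

End CyclicModelGeometry.

(** * The interior of the polygon *)

Section PolygonInterior.
Variables (R : realType) (n : nat) (c : 'rV[R]_2) (rho theta : R).
Hypotheses (n_ge3 : (3 <= n)%N) (rho_gt0 : 0 < rho).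
Implicit Types x y : 'rV[R]_2.

Local Notation step := (angle_step R n).
Local Notation vertex := (vertex n c rho theta).
Local Notation gap := (edge_gap n c rho theta).
Local Notation cell := (sign_cell n c rho theta).
Local Notation hull := (convex_hull (fun k : 'I_n => vertex k)).

Let n_gt0 : (0 < n)%N. Proof. exact: ltn_trans n_ge3. Qed.

Lemma convex_hull_comb3 m (v : 'I_m -> 'rV[R]_2) x1 x2 x3 a1 a2 a3 :
  0 <= a1 -> 0 <= a2 -> 0 <= a3 -> a1 + a2 + a3 = 1 ->
  convex_hull v x1 -> convex_hull v x2 -> convex_hull v x3 ->
  convex_hull v (a1 *: x1 + a2 *: x2 + a3 *: x3).
Proof.
move=> p1 p2 p3 a1E [w1 [w1p w1E ->]] [w2 [w2p w2E ->]] [w3 [w3p w3E ->]].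
exists (fun i => a1 * w1 i + a2 * w2 i + a3 * w3 i); split.
- by move=> i; rewrite !addr_ge0 ?mulr_ge0.
- by rewrite !big_split -!mulr_sumr w1E w2E w3E !mulr1.
rewrite !scaler_sumr -!big_split; apply: eq_bigr => i _ /=.
by rewrite !scalerDl !scalerA.
Qed.

Lemma vertex_mod k : vertex (k %% n) = vertex k.
Proof.
rewrite !vertexE -[in RHS](dirD2piz _ (- (k %/ n)%:Z)) -(step_n R n_ge3).
have /(congr1 (fun m => m%:R : R)) := divn_eq k n; rewrite natrD natrM => e.
congr (_ + _ *: dir _); rewrite rmorphN /= -pmulrn [in RHS]e; ring.
Qed.

Lemma convex_hull_vertex k : hull (vertex k).
Proof.
rewrite -vertex_mod; have kn : (k %% n < n)%N by rewrite ltn_mod.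
exists (fun i => (i == Ordinal kn)%:R); split; first by move=> i; rewrite ler0n.
  by rewrite (bigD1 (Ordinal kn)) //= eqxx big1 ?addr0 // => i /negbTE ->.
rewrite (bigD1 (Ordinal kn)) //= eqxx scale1r big1 ?addr0 // => i /negbTE ->.
by rewrite scale0r.
Qed.

Lemma sum_dir : \sum_(k < n) dir (theta + step * k%:R) = 0.
Proof.
have h0 := sin_half_step_gt0 R n_ge3; set h := step * 2^-1 in h0.
(* The chord from [dir (a - h)] to [dir (a + h)] has signed length 2 sin h in the direction a + pi /
   2; a quarter turn back makes it a multiple of [dir a]. *)
have E a : dir a = (2 * sin h)^-1 *: (dir (a + h - pi / 2) - dir (a - h - pi / 2)).
  apply: rV2P; rewrite !mxE /= !(cosBpihalf, sinBpihalf) !(sinD, cosD, cosN, sinN);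
    by field; rewrite gt_eqF.
(* By E, the sum telescopes. *)
pose f (k : nat) := dir (theta + step * k%:R - h - pi / 2).
have -> : \sum_(k < n) dir (theta + step * k%:R) =
    (2 * sin h)^-1 *: \sum_(0 <= k < n) (f k.+1 - f k).
  rewrite scaler_sumr big_mkord; apply: eq_bigr => k _; rewrite [LHS]E.
  by congr (_ *: (dir _ - _)); rewrite -[k.+1%:R]natr1 /h; field.
rewrite telescope_sumr // /f step_n // mulr0 addr0.
rewrite (_ : theta + _ - h - _ = theta - h - pi / 2 + 2 * pi * 1%:~R); last by ring.
by rewrite dirD2piz subrr scaler0.
Qed.

Lemma convex_hull_centre : hull c.
Proof.
exists (fun _ => n%:R^-1); split; first by move=> i; rewrite invr_ge0 ler0n.
  by rewrite sumr_const card_ord -[_ *+ n]mulr_natr mulVf // nR_neq0.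
rewrite -scaler_sumr (eq_bigr (fun k : 'I_n => c + rho *: dir (theta + step * k%:R))).
  rewrite big_split /= -scaler_sumr sum_dir scaler0 addr0 sumr_const card_ord.
  by rewrite -[c *+ n]scaler_nat scalerA mulVf ?scale1r // nR_neq0.
by move=> k _; rewrite vertexE.
Qed.

(** The gap is affine, so at a convex combination of vertices it is the same combination of its
    vertex values. *)
Lemma hull_gap_ge0 k y : hull y -> 0 <= gap k y.
Proof.
move=> [w [w0 w1 ->]]; pose u := normal n theta k.
have D (F : 'I_n -> 'rV[R]_2) : dotrv u (\sum_i F i) = \sum_i dotrv u (F i).
  apply: (big_morph (dotrv u) (dotrvDr u)).
  by have := dotrvZr 0 u 0; rewrite scale0r mul0r.
suff -> : gap k (\sum_i w i *: vertex i) = \sum_i w i * gap k (vertex i).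
  by apply: sumr_ge0 => i _; rewrite mulr_ge0 // gap_vertex_ge0.
have G x : gap k x = gap k c + dotrv u c - dotrv u x.
  by rewrite gap_centre // /edge_gap dotrvBr; ring.
rewrite G D; under [RHS]eq_bigr => i _ do rewrite [gap k (vertex i)]G mulrBr -dotrvZr.
by rewrite sumrB -mulr_suml w1 mul1r.
Qed.

(* A point y in the angular sector of two consecutive vertices v, v' is
   (1 - A - B) c + A v + B v' with A, B >= 0, and the gap of the edge v v' at y
   is 1 - A - B times its value at c. *)
Lemma cell_sub_hull : cell (fun=> false) `<=` hull.
Proof.
move=> y yin; have s0 := step_gt0 R n_ge3.
have hs := sin_half_step_gt0 R n_ge3; have hc := cos_half_step_gt0 R n_ge3.
have ss : 0 < sin step.
  have -> : step = step * 2^-1 + step * 2^-1 by field.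
  by rewrite sinD; nra.
have [s [a [sge0 ya]]] := polar (y - c).
(* Measured in steps from vertex 0, the angle of y is Q full turns, w steps and a remainder below
   one step, so y lies in the sector of vertices w and w + 1. *)
have [Q [w [_]]] := real_mod_lattice n_ge3 ((a - theta) / step).
rewrite lerBrDr ltrBlDr ler_pdivlMr // ltr_pdivrMr // => /andP[f1 f2].
pose b := a - theta - step * (Q%:~R * n%:R + w%:R).
have b0 : 0 <= b by rewrite /b; lra.
have b1 : b < step by rewrite /b; lra.
have aE : dir a = dir (theta + step * w%:R + b).
  by rewrite -[RHS](dirD2piz _ Q) -(step_n R n_ge3) /b; congr dir; ring.
have hpi : step < pi.
  by have /andP[_] := half_step_bounds R n_ge3; lra.
have sb : 0 <= sin b by apply: sin_ge0_pi; apply/andP; split; lra.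
have sdb : 0 <= sin (step - b) by apply: sin_ge0_pi; apply/andP; split; lra.
pose A := s * sin (step - b) / (rho * sin step).
pose B := s * sin b / (rho * sin step).
have A0 : 0 <= A by rewrite divr_ge0 ?mulr_ge0 // ltW.
have B0 : 0 <= B by rewrite divr_ge0 ?mulr_ge0 // ltW.
have yE : y = (1 - A - B) *: c + A *: vertex w + B *: vertex w.+1.
  have /(congr1 (fun v => (s / sin step) *: v)) := dir_sector (theta + step * w%:R) b step.
  rewrite scalerA divfK ?gt_eqF // -aE -ya => e.
  have -> : vertex w.+1 = c + rho *: dir (theta + step * w%:R + step).
    by rewrite vertexE -[w.+1%:R]natr1 mulrDr mulr1 addrA.
  rewrite -[LHS](subrK c) e vertexE.
  apply: rV2P; rewrite !mxE /A /B; field; by rewrite !gt_eqF.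
have AB : A + B <= 1.
  have [g0 gs] := yin w.
  have : gap w y = (1 - A - B) * gap w c.
    have := gap_vertex_id n c rho theta w; have := gap_vertexS n c rho theta w.
    rewrite yE /edge_gap; move: (vertex w) (vertex w.+1) => v v'.
    rewrite !(dotrvBr, dotrvDr, dotrvZr) => e1 e2.
    have -> : dotrv (normal n theta w) v =
      dotrv (normal n theta w) c + rho * cos (step * 2^-1) by lra.
    have -> : dotrv (normal n theta w) v' =
      dotrv (normal n theta w) c + rho * cos (step * 2^-1) by lra.
    by ring.
  have := gap_centre_gt0 c theta n_ge3 rho_gt0 w.
  have : 0 <= gap w y by rewrite leNgt gs.
  by nra.
rewrite yE; apply: convex_hull_comb3 => //; [lra|lra| | |].
- exact: convex_hull_centre.
- exact: convex_hull_vertex.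
- exact: convex_hull_vertex.
Qed.

(** An interior point with gap at most 0 could be pushed slightly along the outward normal within
    the hull, making the gap negative. Conversely, the cell lies in the hull and is open, as
    periodicity leaves only n strict inequalities. *)
Lemma polygon_interiorE : polygon_interior n c rho theta = cell (fun=> false).
Proof.
apply/seteqP; split => y.
  move=> yint k; pose u := normal n theta k.
  suff g0 : 0 < gap k y by rewrite gt_eqF // ltNge ltW.
  rewrite ltNge; apply/negP => gle.
  have : (fun e : R => y + e *: u) @ (0:R)^'+ --> y.
    apply: cvg_at_right_filter.
    rewrite -[X in _ --> X]addr0 -[X in _ + X](scale0r u).
    by apply: cvgD; [exact: cvg_cst|apply: cvgZr_tmp; exact: cvg_id].
  move=> /(_ _ yint) /= near_hull.
  have : \forall e \near (0:R)^'+, 0 < e /\ hull (y + e *: u).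
    near=> e; split; first by near: e; exact: nbhs_right_gt.
    by near: e.
  move=> /filter_ex [e [e0 /(hull_gap_ge0 k)]].
  have uu : dotrv u u = 1 by rewrite dotrv_dir subrr cos0.
  have -> : gap k (y + e *: u) = gap k y - e.
    by rewrite /edge_gap !(dotrvBr, dotrvDr, dotrvZr) uu; ring.
  by move=> ?; lra.
move=> yin; apply: (@filterS _ _ _ (cell (fun=> false))); first exact: cell_sub_hull.
have : \forall z \near y, forall k : 'I_n, 0 < gap k z.
  apply: (@filter_forall _ _ (fun (k : 'I_n) => [set z | 0 < gap k z]) (nbhs y)) => k.
  have [g0 gs] := yin k.
  have gp : 0 < gap k y by rewrite lt_def g0 leNgt gs.
  exact: (cvgr_gt _ (@gap_continuous R n c rho theta k y) 0 gp).
apply: filterS => z hz k.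
have kn : (k %% n < n)%N by rewrite ltn_mod.
have := hz (Ordinal kn); rewrite /= gap_mod // => g0.
by rewrite gt_eqF // ltNge ltW.
Unshelve. all: by end_near.
Qed.

End PolygonInterior.

(** The count takes the form of a sum of booleans in order to match [arc_dist]. *)
Lemma card_fset_set_image (T : choiceType) (f : nat -> T) n (P : pred nat) :
  {in gtn n &, injective f} ->
  #|` fset_set [set f k | k in [set k | (k < n)%N && P k]]| = (\sum_(k < n) P k)%N.
Proof.
move=> finj; pose s := [seq f k | k <- iota 0 n & P k].
have -> : [set f k | k in [set k | (k < n)%N && P k]] = [set` [fset x in s]%fset].
  apply/seteqP; split => x /=.
    move=> [k /andP[kn Pk] <-]; rewrite !inE; apply/mapP; exists k => //.
    by rewrite mem_filter Pk mem_iota.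
  rewrite !inE => /mapP[k]; rewrite mem_filter mem_iota /= add0n => /andP[Pk kn] ->.
  by exists k => //; rewrite kn.
rewrite set_fsetK card_fseq undup_id.
  rewrite size_map size_filter -sum1_count big_mkcond /=.
  rewrite -(big_mkord xpredT (fun k => nat_of_bool (P k))) /index_iota subn0.
  by apply: eq_bigr => k _; case: (P k).
rewrite map_inj_in_uniq ?filter_uniq ?iota_uniq // => i j.
rewrite !mem_filter !mem_iota /= !add0n => /andP[_ hi] /andP[_ hj].
exact: finj.
Qed.

(** * Separation and realization of the sign cells *)

Section Labelling.
Variables (R : realType) (n : nat) (c : 'rV[R]_2) (rho theta : R).
Hypotheses (n_ge3 : (3 <= n)%N) (rho_gt0 : 0 < rho).
Implicit Types (x y : 'rV[R]_2) (C D : set 'rV[R]_2).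

Local Notation step := (angle_step R n).
Local Notation gap := (edge_gap n c rho theta).
Local Notation cell := (sign_cell n c rho theta).
Local Notation edge_line := (edge_line n c rho theta).
Local Notation model := (cyclic_model n c rho theta).

(** The segment from x to y crosses the separating line, where the gap vanishes. If both gaps had
    the same strict sign, so would the gap at the crossing. *)
Lemma separates_gap k C D x y : separates (edge_line k) C D -> C x -> D y ->
  gap k x * gap k y <= 0.
Proof.
move=> [a [b [eH hC hD]]] /hC /= xb /hD /= yb; have xy := lt_trans xb yb.
rewrite leNgt; apply/negP => pos.
pose t := (b - dotrv a x) / (dotrv a y - dotrv a x).
have t01 : 0 <= t <= 1.
  apply/andP; split; first by apply: divr_ge0; rewrite subr_ge0 ltW.
  by rewrite ler_pdivrMr ?subr_gt0 // mul1r lerD2r ltW.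
have : edge_line k (x + t *: (y - x)).
  rewrite eH /= dotrvDr dotrvZr dotrvBr /t divfK; first by rewrite addrC subrK.
  by rewrite gt_eqF // subr_gt0.
rewrite edge_lineE //= gap_segment => e; move/andP: t01 => [t0 t1].
move: e pos; set u := gap k x; set v := gap k y => e pos.
(* Multiplying by u treats both signs at once. *)
have : ((1 - t) * u + t * v) * u > 0; last by rewrite e mul0r ltxx.
have -> : ((1 - t) * u + t * v) * u = (1 - t) * u ^+ 2 + t * (u * v) by ring.
clear eH.
have u0 : 0 < u ^+ 2 by
  rewrite exprn_even_gt0 //=; apply/eqP => u0; rewrite u0 mul0r ltxx in pos.
have [->|tn] := eqVneq t 0; first by rewrite subr0 mul1r mul0r addr0.
have : 0 < t * (u * v) by rewrite mulr_gt0 // lt_def tn.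
have : 0 <= (1 - t) * u ^+ 2 by rewrite mulr_ge0 ?subr_ge0 // ltW.
by move=> *; lra.
Qed.

Lemma gap_separates k C D : (forall x, C x -> 0 < gap k x) ->
  (forall y, D y -> gap k y < 0) -> separates (edge_line k) C D.
Proof.
move=> hC hD.
exists (normal n theta k), (rho * cos (step * 2^-1) + dotrv (normal n theta k) c).
have E x : gap k x =
    rho * cos (step * 2^-1) + dotrv (normal n theta k) c - dotrv (normal n theta k) x.
  by rewrite /edge_gap dotrvBr; ring.
split.
- rewrite edge_lineE //; apply/seteqP; split => x /=; rewrite E => ?; lra.
- by move=> x /hC; rewrite E /= => ?; lra.
- by move=> x /hD; rewrite E /= => ?; lra.
Qed.

Lemma separates_sym (H C D : set 'rV[R]_2) : separates H C D -> separates H D C.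
Proof.
move=> [a [b [-> hC hD]]]; exists (- a), (- b); split.
- by apply/seteqP; split => x /=; rewrite dotrvNl => h; [rewrite h|apply: oppr_inj].
- by move=> x /hD /=; rewrite dotrvNl ltrN2.
- by move=> x /hC /=; rewrite dotrvNl ltrN2.
Qed.

Lemma separates_cell s s' k : cell s !=set0 -> cell s' !=set0 ->
  separates (edge_line k) (cell s) (cell s') <-> s k != s' k.
Proof.
move=> [x sx] [y sy]; split.
  move=> /separates_gap /(_ sx sy).
  have [[x0 <-] [y0 <-]] := (sx k, sy k) => h.
  have {}h : gap k x * gap k y < 0 by rewrite lt_neqAle mulf_neq0.
  apply/negP => /eqP e; have [xlt|xge] := ltP (gap k x) 0.
    have ylt : gap k y < 0 by rewrite -e.
    by nra.
  have yge : 0 <= gap k y by rewrite leNgt -e -leNgt.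
  by nra.
have pos u z : cell u z -> u k = false -> 0 < gap k z.
  by move=> /(_ k) [z0 zs] uk; rewrite lt_def z0 leNgt zs uk.
have neg u z : cell u z -> u k -> gap k z < 0 by move=> /(_ k) [_ ->].
case sk: (s k); case s'k: (s' k) => // _.
  by apply/separates_sym/gap_separates => z uz; [apply: pos s'k|apply: neg sk].
by apply/gap_separates => z uz; [apply: pos sk|apply: neg s'k].
Qed.

Lemma cell_arc_nonempty (x r : nat) : (1 <= x <= n)%N -> (2 * r <= n + 1)%N ->
  cell (in_arc n x r) !=set0.
Proof.
move=> hx rn; case: r rn => [|r] rn.
  exists c => k; have := gap_centre_gt0 c theta n_ge3 rho_gt0 k.
  by move=> g0; rewrite gt_eqF // ltNge ltW.
have [z [b [b0 bq h]]] := arc_is_cap R n_ge3 hx (ltn0Sn r) rn.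
have cb : 0 < cos (step * b).
  apply: cos_gt0_pihalf; rewrite bq andbT.
  by rewrite (lt_trans _ (mulr_gt0 (step_gt0 R n_ge3) b0)) // oppr_lt0 divr_gt0 ?pi_gt0.
(* At this distance from the centre, the line thresholds become exactly the boundary of the cap. The
   half step added to z below is that of the normals. *)
pose s := rho * cos (step * 2^-1) / cos (step * b).
have s0 : 0 < s by rewrite !mulr_gt0 ?invr_gt0 ?cos_half_step_gt0.
exists (c + s *: dir (theta + step * (z + 2^-1))) => k.
have -> : gap k (c + s *: dir (theta + step * (z + 2^-1))) =
    s * (cos (step * b) - cos (step * (k%:R - z))).
  rewrite gap_polar /s mulrBr divfK ?gt_eqF //; congr (_ - _ * cos _); ring.
have [h1 h2] := h k; rewrite -h2 pmulr_rlt0 // subr_lt0; split => //.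
by rewrite mulf_eq0 negb_or gt_eqF //= subr_eq0 eq_sym.
Qed.

(** In polar coordinates (s, a) about the centre, a gap is negative when the cosine of the angle to
    the normal exceeds t = rho cos (step / 2) / s. Either t >= 1 or s = 0 and no gap is negative, or
    t = cos (step b) with step b < pi / 2 and [cap_is_arc] applies. *)
Lemma gap_is_arc y : exists x r : nat, [/\ (1 <= x <= n)%N, (2 * r <= n + 1)%N &
  forall k, (gap k y < 0) = in_arc n x r k].
Proof.
have hc := cos_half_step_gt0 R n_ge3; have pi0 := pi_gt0 R.
have [s [a [s0 ya]]] := polar (y - c).
have gE k : gap k y = rho * cos (step * 2^-1) - s * cos (theta + step * (k%:R + 2^-1) - a).
  by rewrite -(gap_polar n c) -ya addrC subrK.
have none : (forall k, 0 <= gap k y) ->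
    exists x r : nat, [/\ (1 <= x <= n)%N, (2 * r <= n + 1)%N &
    forall k, (gap k y < 0) = in_arc n x r k].
  move=> h; exists 1%N, 0%N; split; [lia|lia|].
  by move=> k; rewrite ltNge h.
have [sr|rs] := leP s (rho * cos (step * 2^-1)).
  by apply: none => k; rewrite gE; have := cos_le1 (theta + step * (k%:R + 2^-1) - a); nra.
have sgt : 0 < s by apply: lt_trans rs; rewrite mulr_gt0.
pose t := rho * cos (step * 2^-1) / s.
have t0 : 0 < t by rewrite !mulr_gt0 ?invr_gt0.
have t1 : t < 1 by rewrite ltr_pdivrMr // mul1r.
have st := step_gt0 R n_ge3.
pose b := acos t / step.
have bE : step * b = acos t by rewrite mulrC divfK // gt_eqF.
have cb : cos (step * b) = t by rewrite bE acosK // in_itv /=; apply/andP; split; lra.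
have ac0 : 0 < acos t by apply: acos_gt0; apply/andP; split; lra.
have b0 : 0 < b by rewrite divr_gt0.
have bq : step * b < pi / 2.
  rewrite ltNge bE; apply/negP => h; have : cos (acos t) <= cos (pi / 2).
    rewrite ler_cos_pi //; last by apply/andP; split; lra.
    by rewrite ltW //= acos_lepi //; apply/andP; split; lra.
  by rewrite cos_pihalf -bE cb; lra.
have [x [r [hx hr h]]] := cap_is_arc n_ge3 ((a - theta) / step - 2^-1) b0 bq.
exists x, r; split => // k; rewrite -h cb gE.
rewrite subr_lt0 /t ltr_pdivrMr // [s * _]mulrC; congr (_ < cos _ * s).
by field; rewrite gt_eqF.
Qed.

(** Line i separates the cell of the empty arc from that of the one-element arc at i. A line j equal
    to it does so too, which puts j in that arc. *)
Lemma edge_line_inj i j : edge_line i = edge_line j -> i = j %[mod n].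
Proof.
move=> e; pose i' := (if i %% n == 0 then n else i %% n)%N.
have n0 : (0 < n)%N by lia.
have hi' : (1 <= i' <= n)%N by rewrite /i'; case: eqP; have := ltn_pmod i n0; lia.
have ii' : (i = i' %[mod n])%N.
  by rewrite /i'; case: eqP => [->|_]; rewrite ?modnn ?modn_mod.
have ne := cell_arc_nonempty hi' (_ : 2 * 1 <= n + 1)%N; have {ne}ne := ne ltac:(lia).
have ne0 := cell_arc_nonempty hi' (_ : 2 * 0 <= n + 1)%N; have {ne0}ne0 := ne0 ltac:(lia).
have : separates (edge_line i) (cell (in_arc n i' 0)) (cell (in_arc n i' 1)).
  apply/(separates_cell _ ne0 ne).
  rewrite -(in_arc_mod n i' 1) ii' in_arc_mod -[X in in_arc n i' 1 X]addn0 in_arcDl //; last lia.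
rewrite e => /(separates_cell _ ne0 ne); rewrite {1}/in_arc ltn0 /in_arc.
case: ltnP => // h _.
rewrite ii'; apply/eqP; rewrite -(eqn_modDr (n - i')) subnKC ?modnn; last lia.
by rewrite eq_sym -leqn0 -ltnS.
Qed.

Lemma edge_line_inj_in : {in gtn n &, injective edge_line}.
Proof. by move=> i j hi hj /edge_line_inj; rewrite !modn_small. Qed.

Lemma sep_cell (x r y t : nat) : cell (in_arc n x r) !=set0 -> cell (in_arc n y t) !=set0 ->
  sep model (cell (in_arc n x r)) (cell (in_arc n y t)) =
  [set edge_line k | k in [set k | (k < n)%N && (in_arc n x r k != in_arc n y t k)]].
Proof.
move=> nex ney; apply/seteqP; split => H /=.
  rewrite /sep /= cyclic_modelE // => -[[k _ <-] /(separates_cell k nex ney) h].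
  exists (k %% n)%N; last exact: edge_line_mod.
  by rewrite /= ltn_mod !in_arc_mod h andbT; lia.
move=> [k /andP[kn h] <-]; split; first by rewrite cyclic_modelE //; exists k.
exact/separates_cell.
Qed.

End Labelling.

(** * The labelling of the regions *)

Section UniqueLabelling.
Variables (R : realType) (n p : nat) (c : 'rV[R]_2) (rho theta : R).
Hypotheses (n_ge3 : (3 <= n)%N) (p_half : p = ((n + 1) %/ 2)%N) (rho_gt0 : 0 < rho).

Local Notation cell := (sign_cell n c rho theta).
Local Notation edge_line := (edge_line n c rho theta).
Local Notation model := (cyclic_model n c rho theta).

Let n_gt0 : (0 < n)%N. Proof. exact: ltn_trans n_ge3. Qed.
Let p_le : (2 * p <= n + 1)%N. Proof. lia. Qed.

(** The indices of the lines that separate the l-th region from the polygon interior, as prescribed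
    by the labelling. *)
Definition region_arc (l : nat) : nat -> bool :=
  in_arc n (region_start n l) (region_size n l).

Lemma region_arc_nonempty l : (l < 1 + n * p)%N -> cell (region_arc l) !=set0.
Proof.
move=> lnp; apply: cell_arc_nonempty => //; first exact: region_start_bounds.
by have := region_size_le n_gt0 lnp; lia.
Qed.

Lemma region_arc0 : region_arc 0 = fun=> false.
Proof. by apply/funext => k; rewrite /region_arc region_size0. Qed.

Lemma cell_inj s s' : cell s !=set0 -> cell s = cell s' -> s =1 s'.
Proof.
by move=> [y sy] e k; have := sy; rewrite e => /(_ k) [_ <-]; have [_ ->] := sy k.
Qed.

Lemma region_arc_inj l m : (l < 1 + n * p)%N -> (m < 1 + n * p)%N ->
  cell (region_arc l) = cell (region_arc m) -> l = m.
Proof.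
move=> hl hm /(cell_inj (region_arc_nonempty hl)) e.
have d0 : arc_dist n (region_start n l) (region_size n l)
    (region_start n m) (region_size n m) = 0%N.
  by rewrite /arc_dist big1 // => k _; rewrite [in_arc _ _ _ _]e eqxx.
have [bl bm] := (region_start_bounds l n_gt0, region_start_bounds m n_gt0).
have [sl sm] := (region_size_le n_gt0 hl, region_size_le n_gt0 hm).
have pn : (p <= n)%N by lia.
have [l0|[r [x [rp xn lE]]]] := region_indexP hl;
  have [m0|[r' [x' [rp' xn' mE]]]] := region_indexP hm.
- by rewrite l0 m0.
- move: d0; rewrite {1}l0 [region_size n l](_ : _ = 0%N) ?l0 ?region_size0 //.
  rewrite arc_dist_nil //; last exact: leq_trans pn.
  by rewrite mE region_indexS.
- move: d0; rewrite arc_distC [region_size n m](_ : _ = 0%N) ?m0 ?region_size0 //.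
  rewrite arc_dist_nil //; last exact: leq_trans pn.
  by rewrite lE region_indexS.
have s1 : (1 <= region_size n l)%N by rewrite lE region_indexS.
have s2 : (1 <= region_size n m)%N by rewrite mE region_indexS.
have [|] := arc_dist_eq0 bl bm _ s1 s2 d0; first lia.
by rewrite lE mE !region_indexS // => -[->] [->].
Qed.

Lemma region_is_cell C : regions model C ->
  exists2 l, (l < 1 + n * p)%N & C = cell (region_arc l).
Proof.
move=> [y yc <-]; have [x [r [hx hr h]]] := gap_is_arc c theta n_ge3 rho_gt0 y.
have y_in : cell (in_arc n x r) y.
  by move=> k; split; [by move: k; apply/complementP|exact: h].
rewrite (component_cell n_ge3 rho_gt0 y_in).
case: r => [|r] in hr h y_in *.
  by exists 0%N => //; rewrite region_arc0; congr cell; apply/funext.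
have /(leq_mul (leqnn n)) : (r.+1 <= p)%N by lia.
(* The arc starting at x now has length r + 1, so its region has index r n + x, with the offset x -
   1 counted from 0. *)
rewrite mulnS mulnC => rnp; exists (1 + (r * n + x.-1))%N; first by lia.
by rewrite /region_arc !region_indexS ?prednK //; lia.
Qed.

Lemma cell_is_region l : (l < 1 + n * p)%N -> regions model (cell (region_arc l)).
Proof.
move=> hl; have [y yin] := region_arc_nonempty hl; exists y.
  by apply/complementP => // k; have [] := yin k.
exact: component_cell.
Qed.

Lemma sep_region_arc l m : (l < 1 + n * p)%N -> (m < 1 + n * p)%N ->
  sep model (cell (region_arc l)) (cell (region_arc m)) =
  [set edge_line k | k in [set k | (k < n)%N && (region_arc l k != region_arc m k)]].
Proof. by move=> hl hm; apply: sep_cell => //; exact: region_arc_nonempty. Qed.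

(** This reconciles the separating sets given by [sep_region_arc] for region 0 with those demanded
    by [cyclic_labelling]. *)
Lemma edge_lines_of_arc x r : (1 <= x <= n)%N -> (r <= n)%N ->
  [set edge_line k | k in [set k | (k < n)%N && (false != in_arc n x r k)]] =
  [set edge_line (x + k)%N | k in [set k | (k < r)%N]].
Proof.
move=> hx rn; apply/seteqP; split => _ [k /= hk <-].
  have /andP[kn hk'] := hk; exists ((k + (n - x)) %% n)%N.
    by move: hk'; rewrite /in_arc; case: ltnP.
  rewrite -edge_line_mod // modnDmr (_ : x + (k + (n - x)) = k + n)%N; last lia.
  by rewrite modnDr edge_line_mod.
exists ((x + k) %% n)%N; last exact: edge_line_mod.
by rewrite /= ltn_mod n_gt0 in_arc_mod in_arcDl ?hk //; lia.
Qed.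

Lemma cyclic_labelling_cells :
  cyclic_labelling c rho theta (fun l : 'I_(1 + n * p) => cell (region_arc l)).
Proof.
split.
- by move=> l m /(region_arc_inj (ltn_ord l) (ltn_ord m)) /val_inj.
- apply/seteqP; split => [_ [l _ <-]|C /region_is_cell [l hl ->]].
    exact: cell_is_region.
  by exists (Ordinal hl).
- by rewrite polygon_interiorE //= region_arc0.
move=> r x l hr hx lE; rewrite sep_region_arc //= region_arc0.
rewrite (_ : region_arc l = in_arc n x r).
  by apply: edge_lines_of_arc => //; lia.
have -> : (l = 1 + (r.-1 * n + x.-1) :> nat)%N by rewrite lE subn1; lia.
by rewrite /region_arc !region_indexS ?prednK //; lia.
Qed.

(** Each [Rg l] is the cell of some arc, and the labelling prescribes the set of lines separating it
    from the interior. As the n lines are distinct, this set determines the arc. *)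
Lemma cyclic_labelling_uniq (Rg : 'I_(1 + n * p) -> set 'rV[R]_2) :
  cyclic_labelling c rho theta Rg -> forall l, Rg l = cell (region_arc l).
Proof.
move=> [_ rangeE R0 sepE] l.
have R0E : Rg ord0 = cell (region_arc 0) by rewrite R0 polygon_interiorE // region_arc0.
have [l0|[r [x [rp xn lE]]]] := region_indexP (ltn_ord l).
  by rewrite l0 -R0E; congr Rg; apply: val_inj.
have [m hm RlE] : exists2 m, (m < 1 + n * p)%N & Rg l = cell (region_arc m).
  by apply: region_is_cell; rewrite -rangeE; exists l.
have := sepE r.+1 x.+1 l; rewrite R0E RlE sep_region_arc // region_arc0.
have -> : region_arc l = in_arc n x.+1 r.+1 by rewrite /region_arc lE !region_indexS.
rewrite -edge_lines_of_arc; [|lia|lia].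
rewrite subn1 lE add1n /= => /(_ rp xn) /(_ ltac:(lia)) e.
congr cell; apply/funext => k.
have M s k' : (k' < n)%N ->
    [set edge_line k | k in [set k | (k < n)%N && (false != s k)]] (edge_line k')
    <-> s k'.
  move=> kn; split => [[j /= /andP[jn sj]]|sk]; last by exists k' => //=; rewrite kn sk.
  move=> /(edge_line_inj_in n_ge3 rho_gt0) <- //; by case: (s j) sj.
have [kn n0] : (k %% n < n)%N /\ (0 < n)%N by rewrite ltn_mod.
rewrite /region_arc -[in LHS]in_arc_mod -[in RHS]in_arc_mod.
apply/idP/idP => /(M _ _ kn).
  by move=> h; apply/(M (in_arc n x.+1 r.+1) _ kn); rewrite -e.
by rewrite -e => /(M _ _ kn).
Qed.

Lemma varchenko_mx_region_arc (K : comNzRingType) (q : K) :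
  varchenko_mx q model (fun l : 'I_(1 + n * p) => cell (region_arc l)) = block_form q n p.
Proof.
apply/matrixP => i j; rewrite mxE sep_region_arc // block_formE //.
by rewrite card_fset_set_image //; exact: edge_line_inj_in.
Qed.

End UniqueLabelling.

Theorem theorem3p1 (R : realType) (n p : nat) (hn : (3 <= n)%N)
    (hp : p = ((n + 1) %/ 2)%N)
    (c : 'rV[R]_2) (rho theta : R) (hrho : 0 < rho)
    (K : comNzRingType) (q : K) :
  (exists Rg : 'I_(1 + n * p) -> set 'rV[R]_2,
      cyclic_labelling c rho theta Rg) /\
  (forall Rg : 'I_(1 + n * p) -> set 'rV[R]_2,
      cyclic_labelling c rho theta Rg ->
      varchenko_mx q (cyclic_model n c rho theta) Rg = block_form q n p).
Proof.
split; first by eexists; exact: cyclic_labelling_cells.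
move=> Rg /(cyclic_labelling_uniq hn hp hrho) RgE.
rewrite -(varchenko_mx_region_arc c theta hn hp hrho); congr varchenko_mx.
exact/funext.
Qed.
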